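(* For every integer $n\ge 2$, as formal power series in $x$, \[ T_n(x)=\frac{Z_n(x)}{Z_n(x/2)}, \] where $T_n(x)=1+\sum_{k\ge1}t(\{n\}_k)x^{kn}$ and $Z_n(x)=1+\sum_{k\ge1}\zeta(\{n\}_k)x^{kn}$.
   Context: For positive integers $i_1,\dots,i_k$ with $i_1\ge2$: the multiple zeta value is $\zeta(i_1,\dots,i_k)=\sum_{n_1>\cdots>n_k\ge1}n_1^{-i_1}\cdots n_k^{-i_k}$ and the multiple $t$-value is $t(i_1,\dots,i_k)$, the same sum restricted to odd $n_1,\dots,n_k$. $\{n\}_k$ denotes $n$ repeated $k$ times. *)

(* Defs.v *)
From HB Require Import structures.
From mathcomp Require Import all_boot all_order all_algebra.
From mathcomp Require Import all_classical all_reals all_analysis.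

Set Implicit Arguments.
Unset Strict Implicit.
Unset Printing Implicit Defensive.

Import Order.TTheory GRing.Theory Num.Theory.

Local Open Scope ring_scope.
Local Open Scope classical_set_scope.

(* The tuples n_1 > ... > n_k all of whose entries satisfy P. *)
Definition decr_tuples (P : pred nat) (k : nat) : set (seq nat) :=
  [set m : seq nat | [/\ size m = k, sorted gtn m & all P m]].

(* The sum of n_1^{-i_1} ... n_k^{-i_k} over decr_tuples P k, where
   s = [:: i_1; ...; i_k].  The terms are nonnegative, so the sum is taken
   unordered in \bar R; [fine] sends a divergent sum to 0. *)
Definition multiple_sum (R : realType) (P : pred nat) (s : seq nat) : R :=
  fine (\esum_(m in decr_tuples P (size s))
          (\prod_(p <- zip m s) (p.1%:R : R) ^- p.2)%:E).

Definition mzv (R : realType) (s : seq nat) : R :=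
  multiple_sum R (fun a => 0 < a)%N s.

Definition mtv (R : realType) (s : seq nat) : R :=
  multiple_sum R odd s.

(* A formal power series is given by its coefficients: f stands for
   \sum_j f j x^j. *)
Definition fps (R : Type) : Type := nat -> R.

Definition fps_one (R : nzRingType) : fps R := fun j => (j == 0%N)%:R.

Definition fps_mul (R : nzRingType) (f g : fps R) : fps R :=
  fun j => \sum_(i < j.+1) f i * g (j - i)%N.

(* The first j.+1 coefficients of 1 / f, from the recursion
   g_0 = 1 / f_0,  g_{j+1} = - (1 / f_0) \sum_(i <= j) f_{j+1-i} g_i. *)
Fixpoint fps_inv_seq (R : fieldType) (f : fps R) (j : nat) : seq R :=
  if j is j'.+1 then
    let s := fps_inv_seq f j' in
    rcons s (- (f 0%N)^-1 * \sum_(i < j'.+1) f (j'.+1 - i)%N * s`_i)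
  else [:: (f 0%N)^-1].

Definition fps_inv (R : fieldType) (f : fps R) : fps R :=
  fun j => (fps_inv_seq f j)`_j.

Definition fps_div (R : fieldType) (f g : fps R) : fps R :=
  fps_mul f (fps_inv g).

(* f(c x) *)
Definition fps_scale (R : nzRingType) (c : R) (f : fps R) : fps R :=
  fun j => c ^+ j * f j.

(* 1 + \sum_(k >= 1) a k x^(k n), for n >= 1: only the k <= j can contribute
   to the coefficient of x^j. *)
Definition fps_one_plus (R : nzRingType) (n : nat) (a : nat -> R) : fps R :=
  fun j => (j == 0%N)%:R + \sum_(1 <= k < j.+1) a k * (j == k * n)%N%:R.

Definition Tseries (R : realType) (n : nat) : fps R :=
  fps_one_plus n (fun k => mtv R (nseq k n)).

Definition Zseries (R : realType) (n : nat) : fps R :=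
  fps_one_plus n (fun k => mzv R (nseq k n)).

Lemma size_fps_inv_seq (R : fieldType) (f : fps R) j :
  size (fps_inv_seq f j) = j.+1.
Proof. by elim: j => //= j IH; rewrite size_rcons IH. Qed.

Lemma nth_fps_inv_seq (R : fieldType) (f : fps R) j i : (i <= j)%N ->
  (fps_inv_seq f j)`_i = fps_inv f i.
Proof.
elim: j => [|j IH]; first by rewrite leqn0 => /eqP ->.
rewrite leq_eqVlt => /orP[/eqP -> //|ij].
by rewrite /= nth_rcons size_fps_inv_seq ij IH.
Qed.

Lemma fps_mulfV (R : fieldType) (f : fps R) : f 0%N != 0 ->
  fps_mul f (fps_inv f) = fps_one R.
Proof.
move=> f0; apply/funext => -[|j]; rewrite /fps_mul /fps_one.
  by rewrite big_ord1 subn0 /fps_inv /= mulfV.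
rewrite big_ord_recl subn0 {1}/fps_inv /= nth_rcons size_fps_inv_seq ltnn eqxx.
rewrite mulNr mulrN mulVKf //; apply/eqP; rewrite addrC subr_eq0; apply/eqP.
rewrite (reindex_inj rev_ord_inj) /=; apply: eq_bigr => i _.
have ij : (i <= j)%N by rewrite -ltnS.
rewrite /bump /= nth_fps_inv_seq ?leq_subr //.
by rewrite subSS add1n subSS subKn // subSn.
Qed.

Lemma fps_one_plus0 (R : nzRingType) n (a : nat -> R) :
  fps_one_plus n a 0%N = 1.
Proof. by rewrite /fps_one_plus big_geq // addr0. Qed.

(* Main.v *)
(* The coefficient of x^(k n) in the product of 1 + x^n / a^n over the a < N
   with P a is the sum defining the multiple zeta (resp. t-) value of {n}_k,
   restricted to tuples with entries below N.  Splitting the positive a < 2 N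
   into the odd ones and the doubles of the positive b < N gives a polynomial
   identity; letting N tend to infinity coefficientwise yields
   Z_n(x) = T_n(x) Z_n(x/2).  The limits exist because the products at x = 1
   increase and stay below 4. *)

Require Import Defs.
From mathcomp Require Import all_boot all_order all_algebra.
From mathcomp Require Import all_classical all_reals all_analysis.
From mathcomp Require Import ring lra.

Import Order.TTheory GRing.Theory Num.Theory numFieldNormedType.Exports.
Local Open Scope ring_scope.
Local Open Scope classical_set_scope.

(** * Cauchy products of formal power series *)

Lemma fps_mul_trunc (R : nzRingType) (f g : fps R) (j N : nat) : (j <= N)%N ->
  fps_mul f g j = (\poly_(i < N.+1) f i * \poly_(i < N.+1) g i)`_j.
Proof.
move=> jN; rewrite coefM; apply: eq_bigr => i _.
have ij : (i <= j)%N by rewrite -ltnS.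
by rewrite !coef_poly !ltnS (leq_trans ij jN) (leq_trans (leq_subr _ _) jN).
Qed.

(** Associativity is inherited from [{poly R}]: the coefficient of x^j depends only on coefficients
    of index at most j, so cutting all three series after x^j does not change it. *)
Lemma fps_mulA (R : nzRingType) (f g h : fps R) :
  fps_mul f (fps_mul g h) = fps_mul (fps_mul f g) h.
Proof.
apply/funext => j.
have trE (u v : fps R) i : (i <= j)%N -> fps_mul u v i =
    (\poly_(i < j.+1) u i * \poly_(i < j.+1) v i)`_i by exact: fps_mul_trunc.
transitivity ((\poly_(i < j.+1) f i *
    (\poly_(i < j.+1) g i * \poly_(i < j.+1) h i))`_j).
  rewrite coefM; apply: eq_bigr => i _.
  by rewrite trE ?leq_subr // coef_poly ltn_ord.
rewrite mulrA coefM; apply: eq_bigr => i _.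
by rewrite trE -1?ltnS // coef_poly ltnS leq_subr.
Qed.

Lemma fps_mulf1 (R : nzRingType) (f : fps R) : fps_mul f (fps_one R) = f.
Proof.
apply/funext => j; rewrite /fps_mul big_ord_recr /= big1 => [|i _].
  by rewrite add0r subnn /fps_one mulr1.
by rewrite /fps_one subn_eq0 leqNgt ltn_ord mulr0.
Qed.

Lemma fps_mul_divK (R : fieldType) (f g : fps R) : g 0%N != 0 ->
  fps_div (fps_mul f g) g = f.
Proof. by move=> g0; rewrite /fps_div -fps_mulA fps_mulfV // fps_mulf1. Qed.

Lemma esumZl (R : realType) (T : choiceType) (S : set T)
    (a : T -> \bar R) (r : R) :
  0 <= r -> (forall x, (0 <= a x)%E) ->
  (\esum_(x in S) (r%:E * a x) = r%:E * \esum_(x in S) a x)%E.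
Proof.
move=> r0 a0; rewrite /esum -ereal_supZl //; last first.
  apply/set0P; exists (\sum_(x \in set0) a x)%E.
  by exists set0 => //; split; [exact: finite_set0|exact: sub0set].
rewrite image_comp; congr ereal_sup; apply: eq_imagel => A _ /=.
by rewrite ge0_mule_fsumr.
Qed.

(** * Truncated products and truncated sums for nonnegative weights *)

Section Truncation.
Variables (R : realType) (w : nat -> R).

(** The coefficient of x^k is the k-th elementary symmetric polynomial in the weights [w a]; a
    strictly decreasing tuple encodes one k-element set of indices. *)
Definition trunc_prod (P : pred nat) (N : nat) : {poly R} :=
  \prod_(0 <= a < N | P a) (1 + w a *: 'X).

Definition trunc_tuples (P : pred nat) (k N : nat) : set (seq nat) :=
  decr_tuples P k `&` [set m | all (fun a => a < N)%N m].

Lemma trunc_prod0 P : trunc_prod P 0 = 1.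
Proof. by rewrite /trunc_prod big_geq. Qed.

Lemma trunc_prodS P N : trunc_prod P N.+1 =
  trunc_prod P N * (if P N then 1 + w N *: 'X else 1).
Proof. by rewrite /trunc_prod big_mkcond big_nat_recr //= -big_mkcond. Qed.

Lemma coef0_trunc_prod P N : (trunc_prod P N)`_0 = 1.
Proof.
elim: N => [|N IH]; first by rewrite trunc_prod0 coef1.
rewrite trunc_prodS; case: ifP => _; last by rewrite mulr1.
by rewrite mulrDr mulr1 -scalerAr coefD coefZ coefMX mulr0 addr0.
Qed.

Lemma coefS_trunc_prodS P N k : (trunc_prod P N.+1)`_k.+1 =
  (trunc_prod P N)`_k.+1 + (if P N then w N * (trunc_prod P N)`_k else 0).
Proof.
rewrite trunc_prodS; case: ifP => _; last by rewrite mulr1 addr0.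
by rewrite mulrDr mulr1 -scalerAr coefD coefZ coefMX.
Qed.

Lemma decr_tuples0 P : decr_tuples P 0 = [set [::]].
Proof. by apply/seteqP; split => [m [/size0nil ->]|m ->]. Qed.

(** The head of a decreasing tuple is its largest entry. The default [N.+1] puts the empty tuple on
    this side of the splitting. *)
Lemma trunc_tuples_head_neq P k N :
  trunc_tuples P k N.+1 `&` ~` [set m | head N.+1 m = N] =
  trunc_tuples P k N.
Proof.
apply/seteqP; split => [[|a m] [[[sz so aP] aN] /= hN]|[|a m] [[sz so aP] aN]].
- by [].
- split=> //=; move: aN hN so; rewrite /= => /andP[aN _] /eqP hN.
  rewrite (path_sortedE (rev_trans ltn_trans)) => /andP[am _].
  have aN' : (a < N)%N by rewrite ltn_neqAle hN -ltnS.
  rewrite aN'; apply: sub_all am => b /= ba; exact: ltn_trans ba aN'.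
- by split => //=; move=> /eqP; rewrite gtn_eqF.
- split; first by split=> //; apply: sub_all aN => b /= /ltnW.
  by move: aN => /= /andP[aN _] /eqP; rewrite ltn_eqF.
Qed.

Lemma trunc_tuples_head_eq P k N :
  trunc_tuples P k.+1 N.+1 `&` [set m | head N.+1 m = N] =
  if P N then [set N :: m | m in trunc_tuples P k N] else set0.
Proof.
apply/seteqP; split => [[|a m] [[[sz so aP] aN] hN]|m].
- by [].
- move: hN aP so aN sz => /= -> /andP[PN aP] so aN [sz].
  rewrite PN; exists m => //.
  move: so; rewrite (path_sortedE (rev_trans ltn_trans)) => /andP[am so].
  by split.
- case: ifP => // PN [m' [[sz so aP] aN] <-]; split => //; split.
    split => /=; rewrite ?sz ?PN //.
    by rewrite (path_sortedE (rev_trans ltn_trans)) so andbT.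
  by rewrite /= ltnSn; apply: sub_all aN => b /= /ltnW.
Qed.

Hypothesis w0 : forall a, 0 <= w a.

(** Induction on [N]: a nonempty tuple with entries at most [N] either starts with [N] or has all
    entries below [N], which matches the recursion [coefS_trunc_prodS]. *)
Lemma esum_trunc_tuples P k N :
  (\esum_(m in trunc_tuples P k N) (\prod_(a <- m) w a)%:E)%E =
  ((trunc_prod P N)`_k)%:E.
Proof.
have pw0 (m : seq nat) : (0 <= (\prod_(a <- m) w a)%:E)%E.
  by rewrite lee_fin prodr_ge0.
elim: N k => [|N IH] [|k].
- rewrite (_ : trunc_tuples _ _ _ = [set [::]]).
    by rewrite esum_set1 ?big_nil ?trunc_prod0 ?coef1.
  by rewrite /trunc_tuples decr_tuples0; apply/seteqP; split=> [m []|m ->].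
- rewrite trunc_prod0 coef1 (_ : trunc_tuples _ _ _ = set0) ?esum_set0 //.
  by apply/seteqP; split => // -[|a m] [[]].
- rewrite (_ : trunc_tuples _ _ _ = [set [::]]).
    by rewrite esum_set1 // big_nil coef0_trunc_prod.
  by rewrite /trunc_tuples decr_tuples0; apply/seteqP; split=> [m []|m ->].
rewrite (esumID [set m | head N.+1 m = N]) // trunc_tuples_head_neq.
rewrite trunc_tuples_head_eq IH coefS_trunc_prodS EFinD addeC; congr (_ + _)%E.
case: ifP => _; last by rewrite esum_set0.
rewrite esum_image; last by move=> x y _ _ [].
under eq_esum => m _ do rewrite /= big_cons EFinM.
by rewrite esumZl // IH EFinM.
Qed.

(** The unordered sum is a supremum over finite sets of tuples, and the entries occurring in such a
    set are bounded, so it lies in some truncation. *)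
Lemma esum_decr_tuples P k :
  (\esum_(m in decr_tuples P k) (\prod_(a <- m) w a)%:E)%E =
  ereal_sup (range (fun N => ((trunc_prod P N)`_k)%:E)).
Proof.
have pw0 (m : seq nat) : (0 <= (\prod_(a <- m) w a)%:E)%E.
  by rewrite lee_fin prodr_ge0.
apply/eqP; rewrite eq_le; apply/andP; split; last first.
  apply: ge_ereal_sup => _ [N _ <-]; rewrite -esum_trunc_tuples.
  rewrite esum_mkcondr; apply: le_esum => m _; by case: ifP.
apply: ge_ereal_sup => _ [A [finA AD] <-].
move: (finA) => /finite_seqP[s As].
pose N := (\max_(m <- s) \max_(a <- m) a.+1)%N.
apply: (@le_trans _ _ ((trunc_prod P N)`_k)%:E); last first.
  by apply: ereal_sup_ubound; exists N.
rewrite -esum_trunc_tuples; apply: esum_ge; exists A => //.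
split => // m Am; split; first exact: AD.
apply/allP => a am; rewrite /N.
apply: (@leq_trans (\max_(b <- m) b.+1)).
  by rewrite (big_rem a) //= leq_maxl.
by rewrite (big_rem m) ?leq_maxl //=; move: Am; rewrite As.
Qed.

Lemma nondecreasing_trunc_prod P k :
  {homo (fun N => (trunc_prod P N)`_k) : N M / (N <= M)%N >-> N <= M}.
Proof.
move=> N M NM; rewrite -lee_fin -!esum_trunc_tuples.
rewrite (_ : trunc_tuples P k N =
  trunc_tuples P k M `&` [set m | all (fun a => a < N)%N m]); last first.
  apply/seteqP; split => [m [dm mN]|m [[dm _] mN]]; split => //.
  by split => //; apply: sub_all mN => a /= /leq_trans; exact.
rewrite esum_mkcondr; apply: le_esum => m _.
by case: ifP => // _; rewrite lee_fin prodr_ge0.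
Qed.

(** With nonnegative coefficients, each coefficient is at most the value at x = 1; factors with
    [P a] false only enlarge the bound. *)
Lemma trunc_prod_le P N k :
  (trunc_prod P N)`_k <= \prod_(0 <= a < N) (1 + w a).
Proof.
have ge0 M : 0 <= \prod_(0 <= a < M) (1 + w a).
  by apply: prodr_ge0 => a _; rewrite addr_ge0.
have step M : \prod_(0 <= a < M) (1 + w a) <= \prod_(0 <= a < M.+1) (1 + w a).
  by rewrite big_nat_recr //= ler_peMr // lerDl.
elim: N k => [|N IH] [|k]; rewrite ?coef0_trunc_prod.
- by rewrite big_geq.
- by rewrite trunc_prod0 coef1 big_geq.
- by apply: le_trans (step N); rewrite -[leLHS](coef0_trunc_prod P N).
rewrite coefS_trunc_prodS; case: ifP => _; last first.
  by rewrite addr0 (le_trans (IH _)).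
by rewrite big_nat_recr //= mulrDr mulr1 lerD // mulrC ler_wpM2r.
Qed.

Lemma cvg_trunc_prod (B : R) P k :
  (forall N, \prod_(0 <= a < N) (1 + w a) <= B) ->
  (trunc_prod P N)`_k @[N --> \oo] -->
  fine (\esum_(m in decr_tuples P k) (\prod_(a <- m) w a)%:E)%E.
Proof.
move=> wB; have cv : ((trunc_prod P N)`_k)%:E @[N --> \oo] -->
    (\esum_(m in decr_tuples P k) (\prod_(a <- m) w a)%:E)%E.
  rewrite esum_decr_tuples; apply: ereal_nondecreasing_cvgn => N M NM.
  by rewrite lee_fin nondecreasing_trunc_prod.
apply/(@fine_cvg _ _ _ _ (fun N => ((trunc_prod P N)`_k)%:E)).
(* The bound [B] makes the sum finite, so [fine] keeps its value instead of returning the default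
   0. *)
rewrite fineK // ge0_fin_numE; last first.
  by apply: esum_ge0 => m _; rewrite lee_fin prodr_ge0.
apply: (@le_lt_trans _ _ B%:E); last exact: ltry.
rewrite esum_decr_tuples; apply: ge_ereal_sup => _ [N _ <-].
by rewrite lee_fin (le_trans (trunc_prod_le _ _ _)).
Qed.

End Truncation.

(** * The uniform bound for the weights a^-n *)

Definition inv_pow (R : realType) (n a : nat) : R := a%:R ^- n.

Lemma inv_pow_ge0 (R : realType) (n a : nat) : 0 <= inv_pow R n a.
Proof. by rewrite invr_ge0 exprn_ge0. Qed.

(* The bound telescopes: 1 + a^-2 <= a^2 / (a^2 - 1). *)
Lemma prod_inv_pow_le (R : realType) (n N : nat) : (2 <= n)%N ->
  \prod_(0 <= a < N) (1 + inv_pow R n a) <= 4.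
Proof.
move=> n2; have n0 : (0 < n)%N by exact: ltnW.
case: N => [|N]; first by rewrite big_geq // ler1n.
case: N => [|N].
  (* The factor at a = 0 is 1, because [0^-1 = 0] and n > 0. *)
  by rewrite big_nat1 /inv_pow expr0n gtn_eqF // invr0 addr0 ler1n.
(* The factor at a = 1 is 2, and a^2 / (a^2 - 1) multiplied over 2 <= a <= N + 1 gives 2 (N + 1) /
   (N + 2). *)
apply: (@le_trans _ _ (4 * N.+1%:R / N.+2%:R)); last first.
  by rewrite ler_pdivrMr ?ltr0n // ler_wpM2l // ler_nat.
elim: N => [|N IH].
  rewrite big_nat_recr //= big_nat1 /inv_pow expr0n gtn_eqF // invr0 addr0.
  by rewrite expr1n invr1; lra.
rewrite big_nat_recr //=; set x : R := N.+1%:R.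
have x0 : 0 < x by rewrite ltr0n.
have E2 : N.+2%:R = x + 1 :> R by rewrite -natr1.
have E3 : N.+3%:R = x + 2 :> R by rewrite -natr1 E2; lra.
apply: (@le_trans _ _ (4 * x / (x + 1) * (1 + (x + 1) ^- 2))).
  apply: ler_pM.
  - by apply: prodr_ge0 => a _; rewrite addr_ge0 ?inv_pow_ge0.
  - by rewrite addr_ge0 ?inv_pow_ge0.
  - by rewrite -E2.
  rewrite lerD2l /inv_pow E2 lef_pV2 ?posrE ?exprn_gt0 ?addr_gt0 //.
  by rewrite ler_weXn2l // lerDr ltW.
rewrite E2 E3 -subr_ge0.
(* With y = x + 1 the numerator reduces to y^4 - (y^2 - 1) (y^2 + 1) = 1. *)
have -> : 4 * (x + 1) / (x + 2) - 4 * x / (x + 1) * (1 + (x + 1) ^- 2) =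
  4 / ((x + 2) * (x + 1) ^+ 3).
  by clearbody x; field; rewrite !gt_eqF ?addr_gt0.
by rewrite divr_ge0 // mulr_ge0 ?exprn_ge0 ?addr_ge0 ?ltW.
Qed.

(** * Coefficientwise convergence to the generating series *)

Lemma multiple_sum_nseq (R : realType) P n k :
  multiple_sum R P (nseq k n) =
  fine (\esum_(m in decr_tuples P k) (\prod_(a <- m) inv_pow R n a)%:E)%E.
Proof.
rewrite /multiple_sum size_nseq; congr fine; apply: eq_esum => m [<- _ _].
congr EFin; elim: m => [|a m IH]; first by rewrite !big_nil.
by rewrite /= !big_cons IH.
Qed.

Lemma fps_one_plusE (R : nzRingType) n (a : nat -> R) j : (0 < n)%N ->
  a 0%N = 1 -> fps_one_plus n a j = if (n %| j)%N then a (j %/ n)%N else 0.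
Proof.
move=> n0 a0; rewrite /fps_one_plus.
(* Since [a 0 = 1], the constant term becomes the summand k = 0. *)
have -> : (j == 0%N)%:R = a 0%N * (j == 0 * n)%N%:R by rewrite a0 mul1r mul0n.
rewrite -(@big_ltn _ _ _ _ _ (fun k => a k * (j == k * n)%N%:R)) //.
rewrite big_mkord; case: ifPn => [/dvdnP[q jE]|ndvd]; last first.
  rewrite big1 // => k _; case: eqP => [jE|_]; last by rewrite mulr0.
  by rewrite jE dvdn_mull in ndvd.
have qj : (q < j.+1)%N by rewrite ltnS jE leq_pmulr.
have jEk k : (j == k * n)%N = (q == k) by rewrite jE eqn_pmul2r.
have -> : (j %/ n)%N = q by rewrite jE mulnK.
rewrite (bigD1 (Ordinal qj)) //= jEk eqxx mulr1 big1 ?addr0 // => k kq.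
rewrite jEk (_ : q == k = false) ?mulr0 //.
by apply: contraNF kq => /eqP qk; apply/eqP/val_inj.
Qed.

Definition trunc_series (R : realType) (n : nat) (P : pred nat) (N : nat) :
  {poly R} := trunc_prod R (inv_pow R n) P N \Po 'X^n.

Lemma trunc_series0 (R : realType) n P : trunc_series R n P 0 = 1.
Proof. by rewrite /trunc_series trunc_prod0 rmorph1. Qed.

Lemma trunc_seriesS (R : realType) n P N : trunc_series R n P N.+1 =
  trunc_series R n P N * (if P N then 1 + inv_pow R n N *: 'X^n else 1).
Proof.
rewrite /trunc_series trunc_prodS rmorphM /=; case: ifP => _.
  by rewrite rmorphD rmorph1 /= comp_polyZ comp_polyX.
by rewrite rmorph1.
Qed.

Lemma cvg_fps_one_plus (R : realType) P n j : (2 <= n)%N ->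
  (trunc_series R n P N)`_j @[N --> \oo] -->
  fps_one_plus n (fun k => multiple_sum R P (nseq k n)) j.
Proof.
move=> n2; have n0 : (0 < n)%N by exact: ltnW.
rewrite fps_one_plusE //; last first.
  by rewrite multiple_sum_nseq decr_tuples0 esum_set1 big_nil.
under eq_fun do rewrite /trunc_series coef_comp_poly_Xn //.
case: ifP => _; last exact: cvg_cst.
rewrite multiple_sum_nseq.
apply: cvg_trunc_prod (fun N => @prod_inv_pow_le R n N n2).
exact: inv_pow_ge0.
Qed.

Lemma coef_comp_scaleX (R : comNzRingType) (c : R) (p : {poly R}) j :
  (p \Po (c *: 'X))`_j = c ^+ j * p`_j.
Proof.
rewrite comp_polyE (_ : \sum_(i < _) _ = \poly_(i < size p) (c ^+ i * p`_i)).
  by rewrite coef_poly; case: ltnP => // /(nth_default 0) ->; rewrite mulr0.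
by rewrite poly_def; apply: eq_bigr => i _; rewrite exprZn scalerA mulrC.
Qed.

(** * Splitting into odd and even indices, and the limit *)

Lemma inv_pow_double (R : realType) n a :
  inv_pow R n (2 * a) = 2^-1 ^+ n * inv_pow R n a.
Proof. by rewrite /inv_pow natrM exprMn invfM exprVn. Qed.

(** Passing from [N] to [N.+1] adds the indices 2 N and 2 N + 1. The odd one goes to the first
    factor; 1 + x^n / (2 N)^n is the factor of index N evaluated at x / 2. *)
Lemma trunc_series_double (R : realType) n N :
  trunc_series R n (leq 1) (2 * N) =
  trunc_series R n odd (2 * N) *
  (trunc_series R n (leq 1) N \Po (2^-1 *: 'X)).
Proof.
elim: N => [|N IH]; first by rewrite muln0 !trunc_series0 rmorph1 mulr1.
rewrite mulnS [(2 + _)%N]addnC addn2 !trunc_seriesS IH.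
rewrite ltn0Sn muln_gt0 /= oddM /= rmorphM /=; case: ifP => N0; last first.
  (* For N = 0 the even index is not positive and contributes 1 on both sides. *)
  by rewrite rmorph1 !mulr1; ring.
rewrite rmorphD rmorph1 /= comp_polyZ rmorphXn /= comp_polyX exprZn scalerA.
by rewrite inv_pow_double mulr1 [inv_pow R n N * _]mulrC; ring.
Qed.

Lemma fps_mulTZ (R : realType) n : (2 <= n)%N ->
  fps_mul (Tseries R n) (fps_scale 2^-1 (Zseries R n)) = Zseries R n.
Proof.
move=> n2; apply/funext => j.
have cvg_double (u : nat -> R) (l : R) :
    u N @[N --> \oo] --> l -> u (2 * N)%N @[N --> \oo] --> l.
  move=> ul; apply: (@cvg_comp _ _ _ (fun N => 2 * N)%N u) ul.
  apply/cvgnyPge => M; exists M => // N /= MN.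
  by rewrite (leq_trans MN) // leq_pmull.
have cvgZ i := @cvg_fps_one_plus R (leq 1) n i n2.
have cvgT i := @cvg_fps_one_plus R odd n i n2.
(* Both sides are limits of the same coefficient along the even truncations; a coefficient of a
   product is a finite sum, so the limit passes inside. *)
have : (trunc_series R n (leq 1) (2 * N))`_j @[N --> \oo] -->
    fps_mul (Tseries R n) (fps_scale 2^-1 (Zseries R n)) j.
  under eq_fun do rewrite trunc_series_double coefM.
  apply: cvg_big => [|i _]; first exact: add_continuous.
  apply: cvgM; first exact: (cvg_double _ _ (cvgT i)).
  under eq_fun do rewrite coef_comp_scaleX.
  by apply: cvgM; [exact: cvg_cst|exact: cvgZ].
move/cvg_unique; apply; first exact: norm_hausdorff.
exact: (cvg_double _ _ (cvgZ j)).
Qed.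

Theorem theorem2p8 (R : realType) (n : nat) (hn : (2 <= n)%N) :
  Tseries R n = fps_div (Zseries R n) (fps_scale 2^-1 (Zseries R n)).
Proof.
(* Only the numerator is expanded as T_n(x) Z_n(x/2); then the denominator, whose constant term is
   1, cancels. *)
rewrite -{1}(fps_mulTZ R _ hn) fps_mul_divK //.
by rewrite /fps_scale /Zseries mul1r fps_one_plus0 oner_neq0.
Qed.
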